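(* Let $a>1$. Then $\sqrt[a]{BMO}\subseteq\mathsf{Osc}(\exp(L^a))$, and there is a constant $C$, independent of $b$, such that for all $b\in\sqrt[a]{BMO}$ $$\|b\|_{\mathsf{Osc}(\exp(L^a))}\le C\,\|b^a\|_{BMO}^{1/a}.$$
   Context: Functions are on $\mathbb{R}^n$. Cubes are sets $Q=x_0+[0,h)^n$ with $x_0\in\mathbb{R}^n$, $h>0$; $b_Q=\frac1{|Q|}\int_Q b\,dx$. $BMO$ is the space of $b\in L^1_{\mathrm{loc}}(\mathbb{R}^n)$ with $\|b\|_{BMO}=\sup_Q\frac1{|Q|}\int_Q|b(x)-b_Q|\,dx<\infty$. $$\sqrt[a]{BMO}=\{b\in L^1_{\mathrm{loc}}(\mathbb{R}^n): b\ge0\text{ and }b^a\in BMO\}.$$ $\mathsf{Osc}(\exp(L^a))$ is the class of $b\in L^1_{\mathrm{loc}}(\mathbb{R}^n)$ with $\|b\|_{\mathsf{Osc}(\exp(L^a))}=\sup_Q\|b-b_Q\|_{\Phi,Q}<\infty$, where $\Phi(t)=\exp(t^a)-1$ and $\|f\|_{\Phi,Q}=\inf\{\lambda>0:\frac1{|Q|}\int_Q\Phi(|f(x)|/\lambda)\,dx\le1\}$. *)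

(* Defs.v *)
From HB Require Import structures.
From mathcomp Require Import all_boot all_order all_algebra.
From mathcomp Require Import all_classical all_reals all_analysis.

Set Implicit Arguments.
Unset Strict Implicit.
Unset Printing Implicit Defensive.

Import Order.TTheory GRing.Theory Num.Theory.
Import numFieldNormedType.Exports.

Local Open Scope classical_set_scope.
Local Open Scope ring_scope.

(** The product sigma-algebra on [R^n], i.e., the one generated by the
    coordinates (the analogue for row vectors of the library's instance for
    tuples); it is the Borel sigma-algebra. *)

Definition rV_display : measure_display.
Proof. exact: default_measure_display. Qed.

Section rV_measurable.
Context {R : realType} (n : nat).

Let coors (i : 'I_n) (x : 'rV[R]_n) : R := x ord0 i.

Let rV_set0 : g_sigma_preimage coors set0.
Proof. exact: sigma_algebra0. Qed.

Let rV_setC A : g_sigma_preimage coors A -> g_sigma_preimage coors (~` A).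
Proof. exact: sigma_algebraC. Qed.

Let rV_bigcup (F : (set 'rV[R]_n)^nat) :
  (forall i, g_sigma_preimage coors (F i)) ->
  g_sigma_preimage coors (\bigcup_i (F i)).
Proof. exact: sigma_algebra_bigcup. Qed.

HB.instance Definition _ := @isMeasurable.Build rV_display
  'rV[R]_n (g_sigma_preimage coors) rV_set0 rV_setC rV_bigcup.

Lemma measurable_coord (i : 'I_n) :
  measurable_fun [set: 'rV[R]_n] (fun x => x ord0 i).
Proof.
move=> _ Y mY; rewrite setTI; apply: sub_sigma_algebra => /=.
rewrite -bigcup_seq/=; exists i => /=; first by rewrite mem_index_enum.
by exists Y => //; rewrite setTI.
Qed.

Lemma measurable_fun_rV d (T : measurableType d) (f : T -> 'rV[R]_n) :
  (forall i, measurable_fun [set: T] (fun t => f t ord0 i)) ->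
  measurable_fun [set: T] f.
Proof.
move=> mf; suff H : g_sigma_preimage (fun i => coors i \o f) `<=` measurable.
  move=> _ A mA; apply: H; rewrite g_sigma_preimage_comp; by exists A.
apply: smallest_sub; first exact: sigma_algebra_measurable.
rewrite -bigcup_seq; apply: bigcup_sub => i _ A [B mB <-].
exact: mf.
Qed.

End rV_measurable.

(** The Lebesgue measure on the Borel sets of [R^n], by iterated products
    along [R^(n+1) = R x R^n]. *)

Section cons_rV.
Context {R : realType} (n : nat).

Definition cons_rV (p : measurableTypeR R * 'rV[R]_n) : 'rV[R]_n.+1 :=
  \row_i oapp (fun j => p.2 ord0 j) p.1 (unlift ord0 i).

Definition uncons_rV (x : 'rV[R]_n.+1) : measurableTypeR R * 'rV[R]_n :=
  (x ord0 ord0, \row_j x ord0 (lift ord0 j)).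

Lemma cons_rVK : cancel cons_rV uncons_rV.
Proof.
case=> t v; rewrite /uncons_rV /cons_rV mxE unlift_none /=; congr pair.
by apply/rowP => j; rewrite !mxE liftK.
Qed.

Lemma uncons_rVK : cancel uncons_rV cons_rV.
Proof.
move=> x; apply/rowP => i; rewrite mxE.
by case: unliftP => [j|] -> //=; rewrite mxE.
Qed.

Lemma measurable_cons_rV : measurable_fun setT cons_rV.
Proof.
apply: measurable_fun_rV => i; case: (unliftP ord0 i) => [j|] ->.
  rewrite (_ : (fun _ => _) = (fun v : 'rV[R]_n => v ord0 j) \o snd); last first.
    by apply/funext => p /=; rewrite mxE liftK.
  by apply: measurableT_comp => //; exact: measurable_coord.
rewrite (_ : (fun _ => _) = fst) //.
by apply/funext => p /=; rewrite mxE unlift_none.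
Qed.

Lemma measurable_uncons_rV : measurable_fun setT uncons_rV.
Proof.
apply/measurable_fun_pairP; split; first exact: measurable_coord.
apply: measurable_fun_rV => j.
rewrite (_ : (fun _ => _) = fun x : 'rV[R]_n.+1 => x ord0 (lift ord0 j)).
  exact: measurable_coord.
by apply/funext => x /=; rewrite mxE.
Qed.

Section step.
Variable m : {sigma_finite_measure set 'rV[R]_n -> \bar R}.

Definition lebesgue_step : set 'rV[R]_n.+1 -> \bar R :=
  pushforward (lebesgue_measure \x m)%E cons_rV.

Let lebesgue_step0 : lebesgue_step set0 = 0%E.
Proof. by rewrite /lebesgue_step /pushforward preimage_set0 measure0. Qed.

Let lebesgue_step_ge0 A : (0 <= lebesgue_step A)%E.
Proof. exact: (measure_ge0 (lebesgue_measure \x m)%E). Qed.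

Let lebesgue_step_sigma_additive : semi_sigma_additive lebesgue_step.
Proof.
have mf := measurable_cons_rV.
exact: (@measure_semi_sigma_additive _ _ _
  (measure_function_pushforward__canonical__measure_function_Measure
     (lebesgue_measure \x m)%E mf)).
Qed.

HB.instance Definition _ := isMeasure.Build _ _ _ lebesgue_step
  lebesgue_step0 lebesgue_step_ge0 lebesgue_step_sigma_additive.

Let lebesgue_step_sigma_finite : sigma_finite setT lebesgue_step.
Proof.
have /sigma_finiteP[F [TF ndF Foo]] := sigma_finiteT (@lebesgue_measure R).
have /sigma_finiteP[G [TG ndG Goo]] := sigma_finiteT m.
have mFG k : measurable (F k `*` G k).
  by apply: measurableX; [have [] := Foo k|have [] := Goo k].
exists (fun k => uncons_rV @^-1` (F k `*` G k)).
  rewrite predeqE => x; split=> // _.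
  have [i _ Fi] : (\bigcup_i F i) (uncons_rV x).1 by rewrite -TF.
  have [j _ Gj] : (\bigcup_j G j) (uncons_rV x).2 by rewrite -TG.
  exists (maxn i j) => //; split => /=.
  - by move: Fi; exact/subsetPset/ndF/leq_maxl.
  - by move: Gj; exact/subsetPset/ndG/leq_maxr.
move=> k; split.
  by rewrite -[X in measurable X]setTI; exact: measurable_uncons_rV.
rewrite /lebesgue_step /pushforward -comp_preimage.
have -> : uncons_rV \o cons_rV = id by apply/funext; exact: cons_rVK.
have [mF Fk] := Foo k; have [mG Gk] := Goo k.
by rewrite preimage_id product_measure1E// lte_mul_pinfty// ge0_fin_numE.
Qed.

HB.instance Definition _ := Measure_isSigmaFinite.Build _ _ _ lebesgue_step
  lebesgue_step_sigma_finite.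

End step.
End cons_rV.

Fixpoint borel_lebesgue {R : realType} (n : nat) :
    {sigma_finite_measure set 'rV[R]_n -> \bar R} :=
  match n with
  | 0 => \d_(0 : 'rV[R]_0)
  | n'.+1 => lebesgue_step (borel_lebesgue n')
  end.

(** [Rn R n] is [R^n] with the sigma-algebra of Lebesgue measurable sets, and
    [lebesgue_rV] is the (complete) Lebesgue measure on it; compare the
    library's [completed_lebesgue_measure] for [n = 1]. *)

Definition Rn (R : realType) (n : nat) :=
  caratheodory_type (mu_ext (@borel_lebesgue R n)).

HB.instance Definition _ (R : realType) (n : nat) := Measurable.on (Rn R n).

Definition lebesgue_rV {R : realType} {n : nat} : set (Rn R n) -> \bar R :=
  @completed_measure_extension _ _ _ (@borel_lebesgue R n).

HB.instance Definition _ (R : realType) (n : nat) :=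
  Measure.on (@lebesgue_rV R n).

Section function_spaces.
Context {R : realType} {n : nat}.
Implicit Types (b f : Rn R n -> R) (Q : set (Rn R n)) (a : R).

Local Notation mu := (@lebesgue_rV R n).

Definition L1loc : set (Rn R n -> R) := [set b : Rn R n -> R |
  measurable_fun setT b /\
  forall K : set 'rV[R]_n, compact K ->
    (\int[mu]_(x in (K : set (Rn R n))) `|b x|%:E < +oo)%E].

Definition cube (x0 : 'rV[R]_n) (h : R) : set (Rn R n) :=
  [set x : 'rV[R]_n | forall i, x0 ord0 i <= x ord0 i < x0 ord0 i + h].

Definition cubes : set (set (Rn R n)) :=
  [set Q | exists (x0 : 'rV[R]_n) (h : R), 0 < h /\ Q = cube x0 h].

(** [1/|Q| \int_Q f] for [f] with values in the extended reals; it is used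
    for nonnegative integrands only. *)
Definition emean (f : Rn R n -> \bar R) Q : \bar R :=
  (((fine (mu Q))^-1)%:E * \int[mu]_(x in Q) f x)%E.

Definition mean b Q : R := (fine (mu Q))^-1 * \int[mu]_(x in Q) b x.

Definition bmo_norm b : \bar R :=
  ereal_sup [set emean (fun x => `|b x - mean b Q|%:E) Q | Q in cubes].

Definition BMO : set (Rn R n -> R) :=
  [set b : Rn R n -> R | L1loc b /\ (bmo_norm b < +oo)%E].

(** As for classes of functions modulo equality almost everywhere, [0 <= b]
    is meant almost everywhere; the junk values of the power function at
    negative reals therefore do not matter. *)
Definition root_BMO a : set (Rn R n -> R) :=
  [set b : Rn R n -> R | [/\ L1loc b,
               {ae mu, forall x, 0 <= b x} &
               BMO (fun x => b x `^ a)]].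

Definition exp_young a (t : R) : R := expR (t `^ a) - 1.

(** The infimum is taken in the extended reals, so that it is [+oo] when no
    [lambda] is admissible. *)
Definition luxemburg_norm (Phi : R -> R) f Q : \bar R :=
  ereal_inf [set lambda%:E | lambda in [set lambda : R |
    0 < lambda /\ (emean (fun x => (Phi (`|f x| / lambda))%:E) Q <= 1)%E]].

Definition osc_exp_norm a b : \bar R :=
  ereal_sup
    [set luxemburg_norm (exp_young a) (fun x => b x - mean b Q) Q | Q in cubes].

Definition Osc_exp a : set (Rn R n -> R) :=
  [set b : Rn R n -> R | L1loc b /\ (osc_exp_norm a b < +oo)%E].

End function_spaces.

Arguments root_BMO {R} n a.
Arguments Osc_exp {R} n a.

(* Main.v *)
Require Import Defs.
From HB Require Import structures.
From mathcomp Require Import all_boot all_order all_algebra.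
From mathcomp Require Import all_classical all_reals all_analysis.
From mathcomp Require Import measurable_realfun ring lra.

Import Order.TTheory GRing.Theory Num.Theory.
Import numFieldNormedType.Exports.
Import HBSimple.

Local Open Scope classical_set_scope.
Local Open Scope ring_scope.

(** By the John-Nirenberg inequality, [f = b^a] has exponentially integrable
    oscillation on cubes, and [|b - (f_Q)^(1/a)|^a <= |f - f_Q|], while
    [(f_Q)^(1/a)] differs from [b_Q] by at most [2 ||f||^(1/a)].

    The John-Nirenberg inequality is obtained without the Lebesgue
    differentiation theorem: a stopping-time argument on the dyadic subcubes of
    [Q] bounds the exponential sums of the averages of [f] uniformly in the
    generation, and these sums control the integral of any Lipschitz truncation
    of [exp(B |f - f_Q|)] because dyadic step functions are dense in
    [L^1(Q)]. Density holds because the sets whose indicator can be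
    approximated form a sigma-algebra containing the half-spaces. *)

(** * Cubes and their dyadic children *)

Section cubes.
Context {R : realType} {n : nat}.
Local Notation mu := (@lebesgue_rV R n).
Implicit Types (c : 'rV[R]_n) (h : R).

Lemma measurable_Rn (A : set 'rV[R]_n) :
  measurable A -> measurable (A : set (Rn R n)).
Proof. exact: caratheodory_measurable_mu_ext. Qed.

Lemma lebesgue_rVE (A : set 'rV[R]_n) :
  measurable A -> mu A = borel_lebesgue n A.
Proof. exact: measurable_mu_extE. Qed.

Lemma measurable_box (F : 'I_n -> set (measurableTypeR R)) :
  (forall i, measurable (F i)) ->
  measurable [set x : 'rV[R]_n | forall i, F i (x ord0 i)].
Proof.
move=> mF.
rewrite (_ : mkset _ =
    \big[setI/setT]_(i < n) ((fun x : 'rV[R]_n => x ord0 i) @^-1` F i)).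
  apply: bigsetI_measurable => i _; rewrite -[X in measurable X]setTI.
  exact: (@measurable_coord R n i measurableT _ (mF i)).
rewrite -bigcap_seq; apply/seteqP; split=> x /= H i => [_|]; first exact: H.
by apply: H; rewrite /= mem_index_enum.
Qed.

Lemma cubeE c h : cube c h =
  [set x : 'rV[R]_n | forall i, `[c ord0 i, c ord0 i + h[%classic (x ord0 i)].
Proof. by apply/seteqP; split=> x /= H i; move: (H i); rewrite /= in_itv. Qed.

Lemma measurable_borel_cube c h : measurable (cube c h : set 'rV[R]_n).
Proof. by rewrite cubeE; exact: (@measurable_box (fun i => _)). Qed.

Lemma measurable_cube c h : measurable (cube c h).
Proof. by apply: measurable_Rn; exact: measurable_borel_cube. Qed.

End cubes.

Lemma borel_lebesgue_cube {R : realType} n (c : 'rV[R]_n) (h : R) : 0 < h ->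
  borel_lebesgue n (cube c h : set 'rV[R]_n) = (h ^+ n)%:E.
Proof.
elim: n c => [|n IH] c h0 /=.
  by rewrite diracE mem_set//; case.
rewrite /lebesgue_step /pushforward.
rewrite (_ : _ @^-1` _ = `[c ord0 ord0, c ord0 ord0 + h[%classic `*`
   (cube (\row_j c ord0 (lift ord0 j)) h : set 'rV[R]_n)); last first.
  apply/seteqP; split=> [[t v] /= H|[t v] /= [H1 H2] i].
    split=> [|j]; first by have := H ord0; rewrite mxE unlift_none/= in_itv.
    by have := H (lift ord0 j); rewrite !mxE liftK.
  rewrite mxE; case: (unliftP ord0 i) => [j|] -> /=; last by move: H1; rewrite in_itv.
  by have := H2 j; rewrite mxE.
have mQ := @measurable_borel_cube R n (\row_j c ord0 (lift ord0 j)) h.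
rewrite [LHS]product_measure1E; [|exact: measurable_itv|exact: mQ].
rewrite IH// [X in (X * _)%E](_ : _ =
  lebesgue_measure `[c ord0 ord0, c ord0 ord0 + h[%classic)//.
by rewrite lebesgue_measure_itv/= lte_fin ltrDl h0 -EFinD addrAC subrr add0r exprS.
Qed.

Section cube_integrals.
Context {R : realType} {n : nat}.
Local Notation mu := (@lebesgue_rV R n).
Implicit Types (c : 'rV[R]_n) (h : R).

Lemma lebesgue_cube c h : 0 < h -> mu (cube c h) = (h ^+ n)%:E.
Proof.
move=> h0; rewrite lebesgue_rVE; last exact: measurable_borel_cube.
exact: borel_lebesgue_cube.
Qed.

(** The bit [k i] selects the lower or upper half in the direction [i]. Finite functions to [bool]
    make the [2 ^ n] children a finite type that big sums can range over. *)
Definition child_corner c h (k : {ffun 'I_n -> bool}) : 'rV[R]_n :=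
  \row_i (c ord0 i + (k i)%:R * (h / 2)).

Definition child c h k := cube (child_corner c h k) (h / 2).

Lemma child_sub c h k : 0 < h -> child c h k `<=` cube c h.
Proof.
move=> h0 x /= H i; have := H i; rewrite mxE.
by case: (k i) => /=; rewrite ?mul1r ?mul0r; lra.
Qed.

Lemma cube_children c h : 0 < h ->
  cube c h = \big[setU/set0]_(k : {ffun 'I_n -> bool}) child c h k.
Proof.
move=> h0; rewrite -bigcup_seq; apply/seteqP; split=> x; last first.
  by move=> [k _]; exact: child_sub.
move=> H; exists [ffun i => c ord0 i + h / 2 <= (x : 'rV[R]_n) ord0 i].
  by rewrite /= mem_index_enum.
move=> i; rewrite mxE ffunE; have := H i.
by case: (leP (c ord0 i + h / 2)) => H2 /=; rewrite ?mul1r ?mul0r; lra.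
Qed.

Lemma trivIset_child c h (D : set {ffun 'I_n -> bool}) : 0 < h ->
  trivIset D (child c h).
Proof.
move=> h0 k l _ _ [x [Hk Hl]]; apply/ffunP => i.
have := Hk i; have := Hl i; rewrite !mxE.
by case: (k i); case: (l i) => //=; rewrite ?mul1r ?mul0r; lra.
Qed.

Lemma Rintegral_children c h (g : Rn R n -> R) : 0 < h ->
  mu.-integrable (cube c h) (EFin \o g) ->
  \int[mu]_(x in cube c h) g x = \sum_k \int[mu]_(x in child c h k) g x.
Proof.
move=> h0 ig; have := ig; rewrite /Rintegral {1 2}cube_children// => {}ig'.
rewrite integral_bigsetU_EFin//=.
- rewrite -sum_fine//= => k _; apply: integrable_fin_num => //.
    exact: measurable_cube.
  by apply: integrableS ig; [exact: measurable_cube..|exact: child_sub].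
- by move=> i; exact: measurable_cube.
- exact: index_enum_uniq.
- exact: trivIset_child.
- exact: measurable_int ig'.
Qed.

Lemma integrable_cube_cst c h r : 0 < h ->
  mu.-integrable (cube c h) (EFin \o cst r).
Proof.
move=> h0; apply: measurable_bounded_integrable.
- exact: measurable_cube.
- by rewrite [ltLHS]lebesgue_cube// ltry.
- exact: measurable_cst.
- exact: bounded_cst.
Qed.

Lemma Rintegral_cube_cst c h r : 0 < h ->
  \int[mu]_(x in cube c h) r = r * h ^+ n.
Proof.
move=> h0; rewrite Rintegral_cst; last exact: measurable_cube.
by rewrite [X in fine X](lebesgue_cube c h h0).
Qed.

Lemma sum_child_volume h : \sum_(k : {ffun 'I_n -> bool}) (h / 2) ^+ n = h ^+ n.
Proof.
rewrite sumr_const card_ffun card_bool card_ord -[LHS]mulr_natl natrX -exprMn.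
by rewrite mulrC divfK// pnatr_eq0.
Qed.

(** Local integrability speaks of compact sets, and the half-open cube lies in a closed box, which
    is compact. *)
Lemma L1loc_integrable (b : Rn R n -> R) c h : L1loc b ->
  mu.-integrable (cube c h) (EFin \o b).
Proof.
move=> [mb bK].
pose K : set (Rn R n) :=
  [set x : 'rV[R]_n | forall i, `[c ord0 i, c ord0 i + h]%classic (x ord0 i)].
have mK : measurable K.
  by apply: measurable_Rn; apply: (@measurable_box _ _ (fun i => _)).
apply: (@integrableS _ (Rn R n) R mu K) => //; first exact: measurable_cube.
  by move=> x H i; have := H i; rewrite /= in_itv/= => /andP[-> /ltW].
apply/integrableP; split; first by apply/measurable_EFinP; exact: measurable_funTS.
apply: bK; apply: (@rV_compact R n (fun i => `[c ord0 i, c ord0 i + h]%classic)).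
by move=> i; exact: segment_compact.
Qed.

End cube_integrals.

(** * Exponential sums of dyadic averages *)

Section averages.
Context {R : realType} {n : nat}.
Local Notation mu := (@lebesgue_rV R n).
Variable f : Rn R n -> R.
Hypothesis intf : forall (c : 'rV[R]_n) (h : R), 0 < h ->
  mu.-integrable (cube c h) (EFin \o f).
Implicit Types (c : 'rV[R]_n) (h q r : R).

Lemma meanE c h : 0 < h ->
  mean f (cube c h) = (h ^+ n)^-1 * \int[mu]_(x in cube c h) f x.
Proof. by move=> h0; rewrite /mean [X in fine X](lebesgue_cube c h h0). Qed.

Lemma integrable_subr c h q : 0 < h ->
  mu.-integrable (cube c h) (EFin \o (fun x => f x - q)).
Proof.
move=> h0; apply: (@integrableB _ _ _ _ _ _ (EFin \o f) (EFin \o cst q)).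
- exact: measurable_cube.
- exact: intf.
- exact: integrable_cube_cst.
Qed.

Lemma integrable_norm_subr c h q : 0 < h ->
  mu.-integrable (cube c h) (EFin \o (fun x => `|f x - q|)).
Proof.
by move=> h0; exact: (integrable_norm (integrable_subr c h q h0)).
Qed.

(** Triangle inequality for the integral of [f - q]. In the stopping argument it plays the role of
    Chebyshev's inequality. *)
Lemma norm_mean_subr_le c h q : 0 < h ->
  `|mean f (cube c h) - q| * h ^+ n <= \int[mu]_(x in cube c h) `|f x - q|.
Proof.
move=> h0; have hn0 : 0 < h ^+ n by exact: exprn_gt0.
have mQ := measurable_cube c h.
rewrite -[X in _ * X]gtr0_norm// -normrM mulrBl meanE// mulrAC mulVf ?gt_eqF// mul1r.
rewrite -(Rintegral_cube_cst c)// -RintegralB//; last exact: integrable_cube_cst.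
  by apply: le_normr_Rintegral => //; exact: integrable_subr.
exact: intf.
Qed.

(* [\int_Q phi (f_N - q)], where [f_N] averages [f] over the dyadic subcubes of
   generation [N] of [Q]. *)
Fixpoint dyadic_sum (phi : R -> R) N c h q : R :=
  if N is N'.+1 then \sum_k dyadic_sum phi N' (child_corner c h k) (h / 2) q
  else phi (mean f (cube c h) - q) * h ^+ n.

Section exponential.
Variables (L B : R).
Hypothesis L0 : 0 < L.
Hypothesis fL : forall c h, 0 < h ->
  \int[mu]_(x in cube c h) `|f x - mean f (cube c h)| <= L * h ^+ n.
Hypothesis B0 : 0 <= B.
Hypothesis BL : expR (B * (L * (8 + 2 ^+ n))) <= 5 / 4.

Local Notation phi := (fun t : R => expR (B * `|t|)).

(** Enlarging the domain from the child to its parent, whose volume is [2 ^ n] times larger, costs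
    the factor [2 ^+ n]. Added to the stopping threshold [8 * L], this jump gives the constant
    [8 + 2 ^+ n] in [BL]. *)
Lemma mean_child_le c h k : 0 < h ->
  `|mean f (child c h k) - mean f (cube c h)| <= L * 2 ^+ n.
Proof.
move=> h0; have h20 : 0 < h / 2 by lra.
rewrite -(@ler_pM2r _ ((h / 2) ^+ n)) ?exprn_gt0//.
apply: (le_trans (norm_mean_subr_le _ _ _ h20)).
rewrite -mulrA -exprMn mulrCA mulrV ?unitfE// mulr1.
apply: le_trans (fL c h h0).
rewrite (Rintegral_children c h)//; last exact: integrable_norm_subr.
rewrite (bigD1 k)//= lerDl sumr_ge0// => l _.
exact: Rintegral_ge0.
Qed.

(** The triangle inequality, applied to each average, becomes a factor after exponentiation. This is
    the price of recentring at the mean of a stopped cube. *)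
Lemma dyadic_sum_shift N c h q r : 0 < h ->
  dyadic_sum phi N c h q <= expR (B * `|r - q|) * dyadic_sum phi N c h r.
Proof.
elim: N c h => [|N IH] c h h0 /=.
  rewrite mulrA ler_wpM2r ?(exprn_ge0 _ (ltW h0))// -expRD ler_expR -mulrDr.
  rewrite ler_wpM2l// (le_trans _ (ler_normD _ _))//.
  by rewrite [X in _ <= `|X|](_ : _ = mean f (cube c h) - q)//; ring.
rewrite mulr_sumr; apply: ler_sum => k _; apply: IH; lra.
Qed.

(* The children [P] with [|f_P - q| > 8 L] are stopped: Chebyshev's inequality
   bounds [|P|] by [\int_P |f - q| / (8 L)], and the bound for the remaining
   generations is applied with [q] replaced by [f_P]. *)
Lemma dyadic_sum_stopping N :
  (forall M c h, (M < N)%N -> 0 < h ->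
    dyadic_sum phi M c h (mean f (cube c h)) <= 3 / 2 * h ^+ n) ->
  forall c h q, 0 < h -> `|mean f (cube c h) - q| <= 8 * L ->
  dyadic_sum phi N c h q <=
    5 / 4 * h ^+ n + 15 / 64 / L * \int[mu]_(x in cube c h) `|f x - q|.
Proof.
have two0 : (0 : R) <= 2 ^+ n by exact: exprn_ge0.
elim: N => [|N IH] HN c h q h0 hq.
  (* In generation 0 the single average is within [8 * L] of [q], so [BL] already bounds the
     exponential by [5 / 4]; the integral term is only nonnegative. *)
  rewrite /= -[leLHS]addr0 lerD//; last first.
    apply: mulr_ge0; last by apply: Rintegral_ge0.
    by rewrite divr_ge0 ?ltW// divr_gt0.
  rewrite ler_wpM2r ?(exprn_ge0 _ (ltW h0))// (le_trans _ BL)// ler_expR ler_wpM2l//.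
  by rewrite (le_trans hq)// mulrDr (mulrC 8) lerDl mulr_ge0// ltW.
rewrite /= -[h ^+ n]sum_child_volume (Rintegral_children c h)//;
  last exact: integrable_norm_subr.
rewrite !mulr_sumr -big_split/=; apply: ler_sum => k _.
have h20 : 0 < h / 2 by lra.
have v0 : 0 < (h / 2) ^+ n by exact: exprn_gt0.
have [small|big] := leP `|mean f (child c h k) - q| (8 * L).
  by apply: IH => // M d g MN; apply: HN; exact: ltnW.
apply: (le_trans (dyadic_sum_shift N _ _ q (mean f (child c h k)) h20)).
(* The parent is not stopped, so a stopped child exceeds the threshold by at most one
   parent-to-child jump. *)
have jump : `|mean f (child c h k) - q| <= L * (8 + 2 ^+ n).
  have := mean_child_le c h k h0.
  have := ler_normD (mean f (child c h k) - mean f (cube c h)) (mean f (cube c h) - q).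
  by rewrite [X in `|X| <= _](_ : _ = mean f (child c h k) - q); [lra|ring].
have E1 : expR (B * `|mean f (child c h k) - q|) <= 5 / 4.
  by apply: le_trans BL; rewrite ler_expR ler_wpM2l.
have E2 := HN N (child_corner c h k) (h / 2) (ltnSn N) h20.
have I1 : 8 * L * (h / 2) ^+ n <= \int[mu]_(x in child c h k) `|f x - q|.
  apply: le_trans (norm_mean_subr_le _ _ _ h20).
  by rewrite ler_wpM2r ?ltW.
(* Here [15 / 8 = 5 / 4 * 3 / 2] is the recentring factor times the bound for the remaining
   generations, and Chebyshev divides it by [8 * L]. *)
have I2 : 15 / 8 * (h / 2) ^+ n <= 15 / 64 / L * \int[mu]_(x in child c h k) `|f x - q|.
  have -> : 15 / 8 * (h / 2) ^+ n = 15 / 64 / L * (8 * L * (h / 2) ^+ n).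
    by field; rewrite gt_eqF.
  by rewrite ler_wpM2l// divr_ge0 ?ltW// divr_gt0.
apply: (@le_trans _ _ (15 / 8 * (h / 2) ^+ n)); last by lra.
apply: (@le_trans _ _ (5 / 4 * (3 / 2 * (h / 2) ^+ n))); last by lra.
apply: (@le_trans _ _ (expR (B * `|mean f (child c h k) - q|) * (3 / 2 * (h / 2) ^+ n))).
  by rewrite ler_wpM2l ?expR_ge0.
by rewrite ler_wpM2r//; lra.
Qed.

(** With [q] the mean of the cube, the integral term is at most [15 / 64] of the volume, and the
    strong induction on the generation closes because [5 / 4 + 15 / 64 < 3 / 2]. *)
Lemma dyadic_sum_exp_le N c h : 0 < h ->
  dyadic_sum phi N c h (mean f (cube c h)) <= 3 / 2 * h ^+ n.
Proof.
elim/ltn_ind: N c h => N IH c h h0.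
have hn0 : 0 < h ^+ n by exact: exprn_gt0.
apply: (le_trans (dyadic_sum_stopping N _ c h _ h0 _)).
- by move=> M d g MN g0; exact: IH.
- by rewrite subrr normr0 mulr_ge0// ltW.
have : 15 / 64 / L * \int[mu]_(x in cube c h) `|f x - mean f (cube c h)|
    <= 15 / 64 / L * (L * h ^+ n).
  by rewrite ler_wpM2l ?fL// divr_ge0 ?ltW// divr_gt0.
rewrite (_ : 15 / 64 / L * (L * h ^+ n) = 15 / 64 * h ^+ n); first by lra.
by field; rewrite gt_eqF.
Qed.

End exponential.
End averages.

(** * Density of dyadic step functions *)

Section dyadic_steps.
Context {R : realType} {n : nat}.
Local Notation mu := (@lebesgue_rV R n).
Implicit Types (c : 'rV[R]_n) (h : R) (s : Rn R n -> R).

(** The recursion runs parallel to that of [dyadic_sum], so that one induction compares the two; the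
    values of [s] outside the cube are free. *)
Fixpoint dyadic_step N c h s : Prop :=
  if N is N'.+1 then forall k, dyadic_step N' (child_corner c h k) (h / 2) s
  else exists r, forall x, cube c h x -> s x = r.

Lemma eq_dyadic_step N c h s t : 0 < h -> (forall x, cube c h x -> t x = s x) ->
  dyadic_step N c h s -> dyadic_step N c h t.
Proof.
elim: N c h => [|N IH] c h h0 ts /=.
  by move=> [r sr]; exists r => x xQ; rewrite ts// sr.
move=> H k; apply: IH => //; first by lra.
by move=> x /(child_sub c h k h0); exact: ts.
Qed.

Lemma dyadic_stepS N c h s : 0 < h ->
  dyadic_step N c h s -> dyadic_step N.+1 c h s.
Proof.
elim: N c h => [|N IH] c h h0; last first.
  by move=> H k; apply: IH; [lra|exact: H].
by move=> [r sr] k; exists r => x /(child_sub c h k h0); exact: sr.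
Qed.

(** Brings two step functions to a common generation, as [dyadic_step_op] requires. *)
Lemma dyadic_stepD N M c h s : 0 < h ->
  dyadic_step N c h s -> dyadic_step (M + N) c h s.
Proof. by move=> h0 H; elim: M => // M; exact: dyadic_stepS. Qed.

Lemma dyadic_step_op (op : R -> R -> R) N c h s t :
  dyadic_step N c h s -> dyadic_step N c h t ->
  dyadic_step N c h (fun x => op (s x) (t x)).
Proof.
elim: N c h => [|N IH] c h /=; last by move=> sN tN k; exact: IH.
by move=> [r sr] [q tq]; exists (op r q) => x xQ; rewrite sr// tq.
Qed.

Lemma measurable_dyadic_step N c h s : 0 < h ->
  dyadic_step N c h s -> measurable_fun (cube c h) s.
Proof.
elim: N c h => [|N IH] c h h0 /=.
  move=> [r sr]; apply: (@eq_measurable_fun _ _ _ _ _ (cst r)).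
    by move=> x; rewrite inE => /sr ->.
  exact: measurable_cst.
move=> sN; rewrite cube_children//.
set D := \big[_/_]_k _; suff [] : measurable D /\ measurable_fun D s by [].
rewrite /D; elim/big_ind: _.
- by split; [exact: measurable0|exact: measurable_fun_set0].
- move=> A B [mA sA] [mB sB]; split; first exact: measurableU.
  by apply/measurable_funU.
- move=> k _; split; first exact: measurable_cube.
  by apply: IH => //; lra.
Qed.

Lemma bounded_dyadic_step N c h s : 0 < h -> dyadic_step N c h s ->
  exists M, forall x, cube c h x -> `|s x| <= M.
Proof.
elim: N c h => [|N IH] c h h0 /=.
  by move=> [r sr]; exists `|r| => x /sr ->.
move=> sN; have h20 : 0 < h / 2 by lra.
have {IH} /choice[M HM] k := IH _ _ h20 (sN k).
(* The sum of the bounds on the children stands in for their maximum. *)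
exists (\sum_k `|M k|) => x; rewrite {1}cube_children// -bigcup_seq => -[k _ xk].
apply: (le_trans (HM _ _ xk)); rewrite (bigD1 k)//= (le_trans (ler_norm _))//.
by rewrite lerDl sumr_ge0.
Qed.

Lemma integrable_dyadic_step N c h s : 0 < h -> dyadic_step N c h s ->
  mu.-integrable (cube c h) (EFin \o s).
Proof.
move=> h0 sN; apply: measurable_bounded_integrable.
- exact: measurable_cube.
- by rewrite [ltLHS]lebesgue_cube// ltry.
- exact: measurable_dyadic_step sN.
have [M HM] := bounded_dyadic_step _ _ _ _ h0 sN.
by exists M; split; [exact: num_real|move=> x Mx y /HM /le_trans; apply; exact: ltW].
Qed.

Lemma dyadic_step_coord (i : 'I_n) N c h : 0 < h ->
  exists s, dyadic_step N c h s /\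
    forall x, cube c h x -> `|(x : 'rV[R]_n) ord0 i - s x| <= h / 2 ^+ N.
Proof.
elim: N c h => [|N IH] c h h0.
  exists (cst (c ord0 i)); split; first by exists (c ord0 i).
  by move=> x /(_ i) => /andP[H1 H2]; rewrite ger0_norm/= ?expr0 ?divr1; lra.
have h20 : 0 < h / 2 by lra.
have /choice[t Ht] := fun k => IH (child_corner c h k) (h / 2) h20.
(* [idx x] reads off the child containing [x], which glues the step functions of the children into
   one. *)
pose idx x : {ffun 'I_n -> bool} :=
  [ffun i => c ord0 i + h / 2 <= (x : 'rV[R]_n) ord0 i].
have idxE k x : child c h k x -> idx x = k.
  move=> xk; apply/ffunP => j; rewrite ffunE; have := xk j; rewrite mxE.
  by case: (leP (c ord0 j + h / 2)) => ? /=; case: (k j) => //=;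
    rewrite ?mul1r ?mul0r; lra.
exists (fun x => t (idx x) x); split.
  move=> k; have [+ _] := Ht k.
  by apply: eq_dyadic_step => // x /idxE ->.
move=> x; rewrite {1}cube_children// -bigcup_seq => -[k _ xk].
rewrite (idxE k)//; have [_ /(_ x xk)] := Ht k.
by rewrite exprS invfM mulrA.
Qed.

End dyadic_steps.

(** * Closure properties of approximation by dyadic step functions in L^1 of a cube *)

Section dyadic_approximation.
Context {R : realType} {n : nat}.
Local Notation mu := (@lebesgue_rV R n).
Variables (c : 'rV[R]_n) (h : R).
Hypothesis h0 : 0 < h.
Local Notation Q := (cube c h).
Local Notation integrableQ g := (mu.-integrable (cube c h) (EFin \o g)).
Implicit Types (g s : Rn R n -> R) (A S : set (Rn R n)).

Definition approximable g := forall e : R, 0 < e ->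
  exists N s, dyadic_step N c h s /\ \int[mu]_(x in Q) `|g x - s x| <= e.

Let mQ : measurable Q := measurable_cube c h.

Lemma integrable_addr g s : integrableQ g -> integrableQ s ->
  integrableQ (fun x => g x + s x).
Proof.
by move=> ig is_; exact: (@integrableD _ _ _ _ _ mQ (EFin \o g) (EFin \o s)).
Qed.

Lemma integrable_normB g s : integrableQ g -> integrableQ s ->
  integrableQ (fun x => `|g x - s x|).
Proof.
move=> ig is_; apply: (@integrable_norm _ _ _ _ _ (fun x => g x - s x)).
exact: (@integrableB _ _ _ _ _ mQ (EFin \o g) (EFin \o s)).
Qed.

Lemma integrable_lip (f g1 g2 : Rn R n -> R) (K : R) : measurable_fun Q f ->
  integrableQ g1 -> integrableQ g2 ->
  (forall x, Q x -> `|f x| <= K + `|g1 x| + `|g2 x|) -> integrableQ f.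
Proof.
move=> mf i1 i2 fK; have ik := @integrable_cube_cst R n c h K h0.
have j1 := integrable_norm i1; have j2 := integrable_norm i2.
apply: (@le_integrable _ _ _ _ _ mQ _
   (EFin \o (fun x => K + `|g1 x| + `|g2 x|))).
- exact/measurable_EFinP.
- by move=> x /fK H; rewrite /= lee_fin (le_trans H)// ler_norm.
- by apply: integrable_addr => //; exact: integrable_addr.
Qed.

(** A Lipschitz operation applied to step functions of a common generation is again a step function,
    with L^1 error at most [K] times the sum of the two errors. *)
Lemma approximable_lip (op : R -> R -> R) (K : R) g1 g2 :
  (forall a b a' b', `|op a b - op a' b'| <= K * (`|a - a'| + `|b - b'|)) ->
  integrableQ g1 -> integrableQ g2 -> integrableQ (fun x => op (g1 x) (g2 x)) ->
  approximable g1 -> approximable g2 ->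
  approximable (fun x => op (g1 x) (g2 x)).
Proof.
move=> opK i1 i2 iop A1 A2 e e0.
(* Two errors [d] scaled by [K] must fit into [e]; adding 1 keeps the denominator positive. *)
pose d := e / (2 * (`|K| + 1)).
have K0 := normr_ge0 K.
have d0 : 0 < d by rewrite divr_gt0// mulr_gt0//; lra.
have [N1 [s1 [st1 H1]]] := A1 d d0; have [N2 [s2 [st2 H2]]] := A2 d d0.
have {}st1 : dyadic_step (N2 + N1) c h s1 by exact: dyadic_stepD.
have {}st2 : dyadic_step (N2 + N1) c h s2 by rewrite addnC; exact: dyadic_stepD.
have sop := dyadic_step_op op _ _ _ _ _ st1 st2.
exists (N2 + N1)%N, (fun x => op (s1 x) (s2 x)); split => //.
have j1 := integrable_normB _ _ i1 (integrable_dyadic_step _ _ _ _ h0 st1).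
have j2 := integrable_normB _ _ i2 (integrable_dyadic_step _ _ _ _ h0 st2).
have j12 : integrableQ (fun x => `|g1 x - s1 x| + `|g2 x - s2 x|).
  exact: integrable_addr.
apply: (@le_trans _ _ (\int[mu]_(x in Q) (`|K| * (`|g1 x - s1 x| + `|g2 x - s2 x|)))).
  apply: le_Rintegral => //.
  - exact: (integrable_normB _ _ iop (integrable_dyadic_step _ _ _ _ h0 sop)).
  - exact: (@integrableZl _ _ _ _ _ mQ `|K| _ j12).
  - move=> x _; apply: (le_trans (opK _ _ _ _)).
    by rewrite ler_wpM2r ?ler_norm// addr_ge0.
rewrite RintegralZl// RintegralD//.
apply: (@le_trans _ _ (`|K| * (d + d))); first by rewrite ler_wpM2l// lerD.
have <- : (`|K| + 1) * (d + d) = e by rewrite /d; field; rewrite gt_eqF//; lra.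
rewrite ler_wpM2r//; lra.
Qed.

Lemma approximable_limit g : integrableQ g ->
  (forall e : R, 0 < e -> exists s, [/\ integrableQ s, approximable s &
    \int[mu]_(x in Q) `|g x - s x| <= e]) -> approximable g.
Proof.
move=> ig H e e0; have e20 : 0 < e / 2 by lra.
have [s [is_ As gs]] := H _ e20; have [N [t [tN st]]] := As _ e20.
exists N, t; split=> //.
have it := integrable_dyadic_step _ _ _ _ h0 tN.
apply: (@le_trans _ _ (\int[mu]_(x in Q) (`|g x - s x| + `|s x - t x|))).
  apply: le_Rintegral => //; first exact: integrable_normB.
    by apply: integrable_addr; exact: integrable_normB.
  move=> x _; rewrite (le_trans _ (ler_normD _ _))//.
  by rewrite [X in _ <= `|X|](_ : _ = g x - t x)//; ring.
by rewrite RintegralD//; [lra|exact: integrable_normB..].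
Qed.

Lemma integrable_indicQ A : measurable A -> integrableQ (\1_A).
Proof.
move=> mA; apply: measurable_bounded_integrable => //.
- by rewrite [ltLHS]lebesgue_cube// ltry.
exists 1; split; [exact: num_real|move=> x x1 y _ /=].
by rewrite indicE ger0_norm ?ler0n//; case: (_ \in _) => /=; lra.
Qed.

(** An error of size at most 1 carried by a set of small measure is small in L^1. Countable unions,
    half-spaces and Lebesgue measurable sets are all treated in this form. *)
Lemma approximable_indic_diff g : integrableQ g ->
  (forall e : R, 0 < e -> exists s S, [/\ integrableQ s, approximable s,
    measurable S, (mu (S `&` Q) <= e%:E)%E &
    forall x, Q x -> `|g x - s x| <= \1_S x]) -> approximable g.
Proof.
move=> ig H; apply: approximable_limit => // e /H[s [S [is_ As mS Se gs]]].
exists s; split=> //.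
apply: (@le_trans _ _ (\int[mu]_(x in Q) (\1_S x))).
  apply: le_Rintegral => //; first exact: integrable_normB.
  exact: integrable_indicQ.
rewrite /Rintegral integral_indic// -lee_fin fineK//.
by rewrite ge0_fin_numE// (le_lt_trans Se)// ltry.
Qed.

(** Continuity of the measure from above along sets with empty intersection in [Q], which has finite
    measure. *)
Lemma decreasing_small (F : (set (Rn R n))^nat) :
  (forall k, measurable (F k)) ->
  (forall k l, (k <= l)%N -> F l `<=` F k) ->
  (forall x, Q x -> exists k, ~ F k x) ->
  forall e : R, 0 < e -> exists k, (mu (F k `&` Q) <= e%:E)%E.
Proof.
move=> mF dF F0 e e0.
have mFQ k : measurable (F k `&` Q) by exact: measurableI.
have FQ0 : \bigcap_k (F k `&` Q) = set0.
  apply/seteqP; split=> // x Fx; have [_ Qx] := Fx 0%N I.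
  by have [k] := F0 x Qx; apply; have [] := Fx k I.
have : (mu \o (fun k => F k `&` Q)) x @[x --> \oo] --> mu (\bigcap_k (F k `&` Q)).
  apply: nonincreasing_cvg_mu => //.
  - rewrite (@le_lt_trans _ _ (mu Q))//; first by apply: le_measure; rewrite ?inE.
    by rewrite [ltLHS]lebesgue_cube// ltry.
  - by rewrite FQ0; exact: measurable0.
  - by move=> k l kl; apply/subsetPset; apply: setSI; exact: dF.
rewrite FQ0 measure0 => /fine_cvgP[fF /cvgrPdist_le/(_ _ e0)].
move=> [k _ Hk]; case: fF => l _ Hl.
exists (maxn k l); have := Hk (maxn k l) (leq_maxl _ _).
rewrite /= sub0r normrN ger0_norm ?fine_ge0// => H.
by rewrite -[leLHS]fineK ?lee_fin//; exact: (Hl (maxn k l) (leq_maxr _ _)).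
Qed.

(** The sets are typed over ['rV[R]_n] because this class is compared with the Borel sigma-algebra
    generated by the coordinates. *)
Definition approx_sets : set (set 'rV[R]_n) :=
  [set A | measurable (A : set (Rn R n)) /\
           approximable (\1_(A : set (Rn R n)))].

Lemma approximable_cst r : approximable (cst r).
Proof.
move=> e e0; exists 0%N, (cst r); split; first by exists r.
by under eq_Rintegral do rewrite subrr normr0; rewrite Rintegral_cst// mul0r ltW.
Qed.

Lemma eq_approximable g s : g =1 s -> approximable g -> approximable s.
Proof. by move=> /funext ->. Qed.

Lemma approx_setsC A : approx_sets A -> approx_sets (~` A).
Proof.
move=> [mA aA]; split; first exact: measurableC.
have i1 := @integrable_cube_cst R n c h 1 h0.
have E : (fun x => 1 - \1_A x) =1 \1_(~` A) :> (Rn R n -> R).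
  by move=> x; rewrite !indicE in_setC; case: (_ \in _); rewrite ?subrr ?subr0.
apply: (eq_approximable _ _ E).
apply: (approximable_lip (fun a b => a - b) 1 (cst 1)) => //.
- move=> a b a' b'; rewrite mul1r [X in `|X|](_ : _ = (a - a') - (b - b')); last by ring.
  exact: ler_normB.
- exact: integrable_indicQ.
- rewrite (_ : (fun x => _) = \1_(~` A)); last exact/funext.
  by apply: integrable_indicQ; exact: measurableC.
- exact: approximable_cst.
Qed.

Lemma dist_max (a b a' b' : R) :
  `|Num.max a b - Num.max a' b'| <= `|a - a'| + `|b - b'|.
Proof.
rewrite ler_norml; have := ler_norm (a - a'); have := ler_norm (b - b').
rewrite !maxEle.
have := ler_norm (- (a - a')); have := ler_norm (- (b - b')); rewrite !normrN.
by case: (leP a b); case: (leP a' b') => *; lra.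
Qed.

(** The indicator of a union is the maximum of the indicators, a Lipschitz operation. *)
Lemma approx_setsU A S : approx_sets A -> approx_sets S -> approx_sets (A `|` S).
Proof.
move=> [mA aA] [mS aS]; split; first exact: measurableU.
have E : (fun x => Num.max (\1_A x) (\1_S x)) =1 \1_(A `|` S) :> (Rn R n -> R).
  by move=> x; rewrite !indicE in_setU; case: (_ \in A); case: (_ \in S);
   rewrite /= ?maxxx// maxEle ?ler01 ?ler10.
apply: (eq_approximable _ _ E).
apply: (approximable_lip Num.max 1) => //.
- by move=> *; rewrite mul1r dist_max.
- exact: integrable_indicQ.
- exact: integrable_indicQ.
- rewrite (_ : (fun x => _) = \1_(A `|` S)); last exact/funext.
  by apply: integrable_indicQ; exact: measurableU.
Qed.

Lemma approx_sets0 : approx_sets set0.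
Proof. by split; [exact: measurable0|rewrite indic0; exact: approximable_cst]. Qed.

(** The finite partial unions [U k] are approximable, and what they miss decreases to the empty
    set. *)
Lemma approx_sets_bigcup (A : (set 'rV[R]_n)^nat) :
  (forall k, approx_sets (A k)) -> approx_sets (\bigcup_k A k).
Proof.
move=> aA.
have mA k : measurable (A k : set (Rn R n)) by have [] := aA k.
have mU : measurable (\bigcup_k A k : set (Rn R n)) by exact: bigcupT_measurable.
split=> //; apply: approximable_indic_diff; first exact: integrable_indicQ.
move=> e e0; pose U k := \big[setU/set0]_(i < k) A i.
have aU k : approx_sets (U k).
  by rewrite /U; elim/big_ind: _ => //; [exact: approx_sets0|exact: approx_setsU].
have mUk k : measurable (U k : set (Rn R n)) by have [] := aU k.
have mF k : measurable ((\bigcup_k A k `\` U k) : set (Rn R n)) by exact: measurableD.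
have [||k Hk] := decreasing_small _ mF _ _ e e0.
- move=> k l kl; apply: setDS; rewrite /U.
  by rewrite -!bigcup_mkord; apply: bigcup_subset => i /= /leq_trans; exact.
- move=> x _; have [[i _ Ai]|nA] := pselect ((\bigcup_k A k) x).
    exists i.+1 => -[_]; apply; rewrite /U -bigcup_mkord; exists i => //=.
  by exists 0%N => -[].
exists (\1_(U k : set (Rn R n))), ((\bigcup_k A k `\` U k) : set (Rn R n)); split=> //.
- exact: integrable_indicQ.
- by have [] := aU k.
move=> x _; rewrite !indicE in_setD.
case: (boolP (x \in U k)) => xU /=; last by rewrite subr0 andbT ger0_norm.
suff -> : x \in \bigcup_k A k by rewrite subrr normr0.
move: xU; rewrite !inE /U -bigcup_mkord => -[i _ xi]; by exists i.
Qed.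

End dyadic_approximation.

(** * From coordinates and half-spaces to all integrable functions *)

Lemma dist_clamp {R : realType} (u v : R) :
  `|Num.min 1 (Num.max 0 u) - Num.min 1 (Num.max 0 v)| <= `|u - v|.
Proof.
have := ler_norm (u - v); have := ler_norm (v - u).
rewrite [`|v - u|]distrC ler_norml.
case: (leP 0 u) => ?; case: (leP 0 v) => ?; rewrite ?(min_idPr ler01);
  case: (leP 1 u) => ?; case: (leP 1 v) => ?; lra.
Qed.

Section dyadic_density.
Context {R : realType} {n : nat}.
Local Notation mu := (@lebesgue_rV R n).
Variables (c : 'rV[R]_n) (h : R).
Hypothesis h0 : 0 < h.
Local Notation Q := (cube c h).
Local Notation integrableQ g := (mu.-integrable (cube c h) (EFin \o g)).
Implicit Types (g s : Rn R n -> R) (A S : set (Rn R n)).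
Let mQ : measurable Q := measurable_cube c h.

Let coord (i : 'I_n) : Rn R n -> R := fun x => (x : 'rV[R]_n) ord0 i.

Let measurable_coordQ i : measurable_fun setT (coord i).
Proof.
by move=> _ Y mY; apply: measurable_Rn; exact: (@measurable_coord R n i measurableT _ mY).
Qed.

Lemma integrable_coord i : integrableQ (coord i).
Proof.
apply: measurable_bounded_integrable => //.
- by rewrite [ltLHS]lebesgue_cube// ltry.
- by apply: measurable_funTS; exact: measurable_coordQ.
(* The approximation of generation 0, with error [h], shows that the coordinate is bounded on the
   cube. *)
have [s [sN xs]] := dyadic_step_coord i 0 c h h0.
have [M HM] := bounded_dyadic_step _ _ _ _ h0 sN.
exists (M + h / 2 ^+ 0); split; [exact: num_real|move=> z Mz y yQ /=].
apply: (le_trans _ (ltW Mz)).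
have := ler_normD (coord i y - s y) (s y); rewrite subrK.
by have := HM _ yQ; have := xs _ yQ; rewrite /coord; lra.
Qed.

Lemma approximable_coord i : approximable c h (coord i).
Proof.
move=> e e0.
pose d := e / h ^+ n.
have hn0 : 0 < h ^+ n by exact: exprn_gt0.
have d0 : 0 < d by exact: divr_gt0.
have [k hk] : exists k, h / 2 ^+ k <= d.
  have : (h / 2 ^+ k) @[k --> \oo] --> (0 : R).
    under eq_cvg do rewrite -exprVn.
    have : (geometric h (2^-1 : R)) @ \oo --> (0 : R).
      by apply: cvg_geometric; rewrite ger0_norm; lra.
    by [].
  move=> /cvgrPdist_le/(_ _ d0)[k _ /(_ k (leqnn k))] /=.
  by rewrite sub0r normrN => /ler_normlW; exists k.
have [s [sN xs]] := dyadic_step_coord i k c h h0.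
exists k, s; split => //.
apply: (@le_trans _ _ (\int[mu]_(x in Q) d)).
  apply: le_Rintegral => //.
  - by apply: integrable_normB; [exact: integrable_coord|exact: integrable_dyadic_step sN].
  - exact: integrable_cube_cst.
  - by move=> x /xs /le_trans; exact.
by rewrite Rintegral_cube_cst// divfK// gt_eqF.
Qed.

(** A steep ramp in the coordinate is Lipschitz, hence approximable. It differs from the indicator
    only in the strip [F k] of width [k.+1%:R^-1] above [t], and these strips decrease to the empty
    set. *)
Lemma approx_sets_gt i t : approx_sets c h [set x : 'rV[R]_n | t < x ord0 i].
Proof.
set A := mkset _.
have mgt u : measurable ([set x : 'rV[R]_n | u < x ord0 i] : set (Rn R n)).
  have := measurable_coordQ i measurableT `]u, +oo[%classic (measurable_itv _).
  by rewrite setTI; congr measurable; apply/seteqP; split => x /=; rewrite in_itv/= andbT.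
have mA : measurable (A : set (Rn R n)) by exact: mgt.
split=> //; apply: approximable_indic_diff => //; first exact: integrable_indicQ.
move=> e e0.
pose F k : set (Rn R n) := A `\` [set x : 'rV[R]_n | t + k.+1%:R^-1 < x ord0 i].
have mF k : measurable (F k) by apply: measurableD => //; exact: mgt.
have [||k Hk] := decreasing_small c h h0 F mF _ _ e e0.
- move=> k l kl; apply: setDS => x /=; apply: le_lt_trans.
  by rewrite lerD2l lef_pV2 ?posrE// ler_nat.
- move=> x _; have [/ltr_add_invr[k xk]|xt] := ltP t (coord i x).
    by exists k => -[_]; exact.
  by exists 0%N => -[/= tx]; move: xt; rewrite leNgt /coord tx.
(* [approximable_lip] takes a binary operation, so the ramp is paired with the constant 0. *)
pose op (a b : R) := Num.min 1 (Num.max 0 (k.+1%:R * (a - t))).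
have opE x : `|\1_(A : set (Rn R n)) x - op (coord i x) 0| <= \1_(F k) x.
  have k0 : (0 : R) < k.+1%:R by [].
  rewrite !indicE /op; set u := k.+1%:R * _; rewrite in_setD.
  have -> : (x \in (A : set (Rn R n))) = (t < coord i x).
    by apply/idP/idP; rewrite inE.
  have -> : (x \in [set x : 'rV[R]_n | t + k.+1%:R^-1 < x ord0 i]) = (1 < u).
    rewrite /u mulrC -ltr_pdivrMr// div1r ltrBrDl.
    by apply/idP/idP; rewrite inE.
  have : (0 < u) = (t < coord i x) by rewrite /u pmulr_rgt0// subr_gt0.
  move=> <-; have [u0|u0] := ltP 0 u; last first.
    by rewrite (min_idPr ler01) subr0 normr0.
  by have [u1|u1] := ltP 1 u; rewrite /= ?subrr ?normr0// ler_norml; lra.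
have iop : integrableQ (fun x => op (coord i x) 0).
  apply: (integrable_lip _ _ h0 _ (cst 1) (cst 0) 0).
  - apply: measurable_funTS; apply: measurable_minr.
      exact: measurable_cst.
    apply: measurable_maxr; first exact: measurable_cst.
    apply: measurable_funM; first exact: measurable_cst.
    apply: measurable_funB; first exact: measurable_coordQ.
    exact: measurable_cst.
  - exact: integrable_cube_cst.
  - exact: integrable_cube_cst.
  - move=> x _; rewrite /op /= normr1 normr0 add0r addr0 ger0_norm.
      by rewrite ge_min lexx.
    by rewrite le_min ler01 le_max lexx.
exists (fun x => op (coord i x) 0), (F k); split => //.
- apply: (approximable_lip _ _ h0 op k.+1%:R (coord i) (cst 0)) => //.
  + move=> a b a' b'; rewrite mulrDr -[leLHS]addr0 lerD ?mulr_ge0//.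
    rewrite -[X in X * _]gtr0_norm// -normrM /op.
    set v := _ * _; set v' := _ * (a' - t).
    rewrite [X in _ <= `|X|](_ : _ = v - v'); last by rewrite /v /v'; ring.
    exact: dist_clamp.
  + exact: integrable_coord.
  + exact: integrable_cube_cst.
  + exact: approximable_coord.
  + exact: approximable_cst.
Qed.


Lemma borel_approx_sets (A : set 'rV[R]_n) : measurable A -> approx_sets c h A.
Proof.
have sC B : approx_sets c h B -> approx_sets c h (~` B) by exact: approx_setsC.
have sU (F : (set 'rV[R]_n)^nat) :
    (forall k, approx_sets c h (F k)) -> approx_sets c h (\bigcup_k F k).
  exact: approx_sets_bigcup.
have s0 : approx_sets c h set0 by exact: approx_sets0.
move: A; apply: smallest_sub.
  by split => // B sB; rewrite setTD; exact: sC.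
rewrite -bigcup_seq; apply: bigcup_sub => i _ _ [Y mY <-]; rewrite setTI.
(* A second generation argument, now on the line: [C] is a sigma-algebra, so it suffices that it
   contains the intervals []a, b]], whose preimages are differences of half-spaces. *)
pose C := [set Y : set R | approx_sets c h ((fun x : 'rV[R]_n => x ord0 i) @^-1` Y)].
suff : C Y by [].
move: Y mY; apply: smallest_sub.
  split; first by rewrite /C/= preimage_set0.
  - by move=> Y CY; rewrite setTD /C /= preimage_setC; exact: sC.
  - by move=> Y CY; rewrite /C /= preimage_bigcup; exact: sU.
move=> _ [[a b] _ <-]; rewrite /C/=.
rewrite (_ : _ @^-1` _ = ~` ((~` [set x : 'rV[R]_n | a < x ord0 i]) `|`
   [set x : 'rV[R]_n | b < x ord0 i])).
  apply: sC; apply: approx_setsU => //; last exact: approx_sets_gt.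
  by apply: approx_setsC => //; exact: approx_sets_gt.
rewrite setCU setCK; apply/seteqP; split => x /=; rewrite in_itv/=.
  by move=> /andP[-> xb]; split=> //; apply/negP; rewrite -leNgt.
by move=> [-> /negP]; rewrite -leNgt.
Qed.

(** The completed measure is an outer measure, an infimum over countable Borel covers. A nearly
    optimal cover of the part of [A] in the cube has a Borel union [B] exceeding it by measure at
    most [e]. *)
Lemma measurable_approximable A : measurable A -> approximable c h (\1_A).
Proof.
move=> mA; apply: approximable_indic_diff => //; first exact: integrable_indicQ.
move=> e e0.
have mAQ : measurable (A `&` Q) by exact: measurableI.
have fAQ : mu (A `&` Q) \is a fin_num.
  rewrite ge0_fin_numE// (@le_lt_trans _ _ (mu Q))//.
    by apply: le_measure; rewrite ?inE//; exact: subIsetr.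
  by rewrite [ltLHS]lebesgue_cube// ltry.
have [_ [F [mF AF] <-] Fe] := @lb_ereal_inf_adherent _
  [set (\sum_(0 <= k <oo) borel_lebesgue n (F k))%E |
    F in @measurable_cover _ 'rV[R]_n (A `&` Q)] e e0 fAQ.
pose B : set (Rn R n) := \bigcup_k F k.
have mFR k : measurable (F k : set (Rn R n)) by exact: measurable_Rn.
have mB : measurable B by exact: bigcupT_measurable.
have muB : (mu B <= mu (A `&` Q) + e%:E)%E.
  apply: le_trans (ltW Fe).
  rewrite (_ : (\sum_(0 <= k <oo) borel_lebesgue n (F k))%E =
    (\sum_(0 <= k <oo) mu (F k))%E); last first.
    by apply: eq_eseriesr => k _; rewrite lebesgue_rVE.
  exact: measure_sigma_subadditive.
have [_ aB] := borel_approx_sets _ (bigcupT_measurable _ mF).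
exists (\1_B), (B `\` (A `&` Q)); split => //.
- exact: integrable_indicQ.
- exact: measurableD.
- apply: (@le_trans _ _ (mu (B `\` (A `&` Q)))).
    apply: le_measure; rewrite ?inE//.
      by apply: measurableI => //; exact: measurableD.
    exact: measurableD.
  rewrite measureD//; last first.
    by rewrite (le_lt_trans muB)// -(fineK fAQ) -EFinD ltry.
  by rewrite setIidr// leeBlDl.
move=> x Qx; rewrite !indicE in_setD in_setI (mem_set Qx) andbT.
case: (boolP (x \in A)) => /= xA; last first.
  by rewrite sub0r normrN andbT ger0_norm.
suff -> : x \in B by rewrite subrr normr0.
by rewrite inE; apply: AF; split=> //; move: xA; rewrite inE.
Qed.

Lemma sfun_approximable (s : {sfun (Rn R n) >-> R}) : approximable c h (fun x => s x).
Proof.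
(* Integrability is carried through the induction on the sum because [approximable_lip] asks for
   it. *)
suff [//] : approximable c h (fun x => s x) /\ integrableQ (fun x => s x).
rewrite (_ : (fun x : Rn R n => s x) =
  fun x => \sum_(y <- finmap.enum_fset (fset_set (range s)))
    y * \1_(s @^-1` [set y]) x); last first.
  by apply/funext => x; rewrite fimfunE fsbig_finite.
elim: (finmap.enum_fset _) => [|y r [IH1 IH2]].
  rewrite (_ : (fun _ => _) = cst 0); last by apply/funext => x; rewrite big_nil.
  by split; [exact: approximable_cst|exact: integrable_cube_cst].
rewrite (_ : (fun _ => _) = fun x => y * \1_(s @^-1` [set y]) x +
    (\sum_(z <- r) z * \1_(s @^-1` [set z]) x)); last first.
  by apply/funext => x; rewrite big_cons.
have ms : measurable (s @^-1` [set y]).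
  by rewrite -[X in measurable X]setTI; exact: measurable_funP.
have i1 := integrable_indicQ c h h0 _ ms.
have i2 : integrableQ (fun x => y * \1_(s @^-1` [set y]) x +
    (\sum_(z <- r) z * \1_(s @^-1` [set z]) x)).
  apply: integrable_addr => //.
  exact: (@integrableZl _ _ _ _ _ mQ y _ i1).
split=> //.
apply: (approximable_lip _ _ h0 (fun a b => y * a + b) (`|y| + 1)
   (\1_(s @^-1` [set y])) (fun x => \sum_(z <- r) z * \1_(s @^-1` [set z]) x)) => //.
  move=> a b a' b'.
  rewrite (_ : _ - _ = y * (a - a') + (b - b')); last by ring.
  apply: (le_trans (ler_normD _ _)); rewrite normrM.
  have := normr_ge0 (a - a'); have := normr_ge0 (b - b'); have := normr_ge0 y; nra.
exact: measurable_approximable.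
Qed.

Lemma integrable_approximable g : integrableQ g -> approximable c h g.
Proof.
move=> ig; apply: approximable_limit => // e e0.
have [s [is_ _ /fine_cvgP[_ /cvgrPdist_le/(_ _ e0)[k _ /(_ k (leqnn k)) H]]]] :=
  approximation_sfun_integrable mQ ig.
exists (s k); split; [exact: is_|exact: sfun_approximable|].
by move: H; rewrite /= sub0r normrN => /ler_normlW.
Qed.

End dyadic_density.

(** * The John-Nirenberg inequality *)

(** For [v <= u], factor out [expR u] and use [1 + x <= expR x] at [x = v - u]. *)
Lemma expR_lip {R : realType} (m u v : R) : u <= m -> v <= m ->
  `|expR u - expR v| <= expR m * `|u - v|.
Proof.
move=> um vm; wlog vu : u v um vm / v <= u => [H|].
  by have [/H|/ltW/H] := leP v u; [apply|rewrite distrC (distrC v); apply].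
rewrite !ger0_norm ?subr_ge0 ?ler_expR//.
have -> : expR v = expR u * expR (v - u) by rewrite -expRD addrC subrK.
rewrite -[X in X - _]mulr1 -mulrBr ler_pM ?expR_ge0 ?ler_expR//.
  by rewrite subr_ge0 expR_le1 subr_le0.
have := expR_ge1Dx (v - u); lra.
Qed.

Section john_nirenberg.
Context {R : realType} {n : nat}.
Local Notation mu := (@lebesgue_rV R n).
Variable f : Rn R n -> R.
Hypothesis intf : forall (c : 'rV[R]_n) (h : R), 0 < h ->
  mu.-integrable (cube c h) (EFin \o f).
Implicit Types (c : 'rV[R]_n) (h q r : R).

Section lipschitz.
Variables (phi : R -> R) (K : R).
Hypothesis mphi : measurable_fun setT phi.
Hypothesis phiK : forall t u, `|phi t - phi u| <= K * `|t - u|.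

Let K0 : 0 <= K.
Proof. by have := phiK 1 0; rewrite subr0 normr1 mulr1; apply: le_trans. Qed.

Lemma integrable_lip_subr c h q : 0 < h ->
  mu.-integrable (cube c h) (EFin \o (fun x => phi (f x - q))).
Proof.
move=> h0; have i := integrable_subr f intf c h q h0.
apply: (integrable_lip c h h0 _ (fun x => K * (f x - q)) (cst 0) `|phi 0|).
- apply: (measurableT_comp mphi); apply/measurable_EFinP.
  exact: measurable_int i.
- exact: (@integrableZl _ _ _ _ _ (measurable_cube c h) K _ i).
- exact: integrable_cube_cst.
move=> x _; rewrite normr0 addr0 normrM (ger0_norm K0).
have := phiK (f x - q) 0; rewrite subr0.
have := ler_normD (phi (f x - q) - phi 0) (phi 0); rewrite subrK; lra.
Qed.

(** Moving the constant from [r] to the mean costs at most the integral of [|f - r|] once more. *)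
Lemma Rintegral_norm_sub_mean_le c h r : 0 < h ->
  \int[mu]_(x in cube c h) `|f x - mean f (cube c h)| <=
  2 * \int[mu]_(x in cube c h) `|f x - r|.
Proof.
move=> h0; set m := mean f _.
have ir := integrable_norm_subr f intf c h r h0.
have ic := @integrable_cube_cst R n c h `|m - r| h0.
apply: (@le_trans _ _ (\int[mu]_(x in cube c h) (`|f x - r| + `|m - r|))).
  apply: le_Rintegral; first exact: measurable_cube.
  - exact: integrable_norm_subr.
  - exact: integrable_addr.
  - move=> x _; rewrite [in leRHS](distrC m) (le_trans _ (ler_normD _ _))//.
    by rewrite [X in _ <= `|X|](_ : _ = f x - m)//; ring.
rewrite (RintegralD (measurable_cube c h) ir ic) Rintegral_cube_cst//.
have := norm_mean_subr_le f intf c h r h0; rewrite -/m; lra.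
Qed.

(** On each subcube of generation [N], replacing [f] by its mean inside [phi] costs [K] times the
    oscillation. That is at most twice the integral of [|f - s|], as [s] is constant there. *)
Lemma Rintegral_lip_dyadic_step_le N c h s q : 0 < h -> dyadic_step N c h s ->
  \int[mu]_(x in cube c h) phi (f x - q) <=
  dyadic_sum f phi N c h q + 2 * K * \int[mu]_(x in cube c h) `|f x - s x|.
Proof.
elim: N c h => [|N IH] c h h0 /= sN; last first.
  have h20 : 0 < h / 2 by lra.
  rewrite (Rintegral_children c h)//; last exact: integrable_lip_subr.
  rewrite (Rintegral_children c h _ h0); last first.
    apply: integrable_normB => //; first exact: intf.
    exact: (@integrable_dyadic_step _ _ N.+1).
  rewrite mulr_sumr -big_split/=; apply: ler_sum => k _; exact: IH.
have [r sr] := sN.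
rewrite [X in _ + _ * X](@eq_Rintegral _ _ _ _ _ (fun x => `|f x - r|)); last first.
  by move=> x; rewrite inE => /sr ->.
have ib := integrable_norm_subr f intf c h (mean f (cube c h)) h0.
have ic := @integrable_cube_cst R n c h (phi (mean f (cube c h) - q)) h0.
have iK := @integrableZl _ _ _ _ _ (measurable_cube c h) K _ ib.
apply: (@le_trans _ _ (\int[mu]_(x in cube c h)
    (phi (mean f (cube c h) - q) + K * `|f x - mean f (cube c h)|))).
  apply: le_Rintegral; first exact: measurable_cube.
  - exact: integrable_lip_subr.
  - exact: (integrable_addr _ _ _ _ ic iK).
  - move=> x _; rewrite -lerBlDl (le_trans (ler_norm _))// (le_trans (phiK _ _))//.
    by rewrite [X in K * `|X|](_ : _ = f x - mean f (cube c h))//; ring.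
rewrite (RintegralD (measurable_cube c h) ic iK) Rintegral_cube_cst// lerD2l.
rewrite (RintegralZl _ (measurable_cube c h) ib) (mulrC 2) -mulrA ler_wpM2l//.
exact: Rintegral_norm_sub_mean_le.
Qed.

End lipschitz.

Variables (L B : R).
Hypothesis L0 : 0 < L.
Hypothesis fL : forall c h, 0 < h ->
  \int[mu]_(x in cube c h) `|f x - mean f (cube c h)| <= L * h ^+ n.
Hypothesis B0 : 0 <= B.
Hypothesis BL : expR (B * (L * (8 + 2 ^+ n))) <= 5 / 4.

Lemma le_dyadic_sum (phi psi : R -> R) N c h q : 0 < h ->
  (forall t, phi t <= psi t) ->
  dyadic_sum f phi N c h q <= dyadic_sum f psi N c h q.
Proof.
move=> h0 pp; elim: N c h h0 => [|N IH] c h h0 /=.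
  by rewrite ler_wpM2r// exprn_ge0// ltW.
apply: ler_sum => k _; apply: IH; lra.
Qed.

(* Truncating the exponent makes the exponential Lipschitz. *)
Let phi (m : nat) (t : R) := expR (Num.min (B * `|t|) m%:R).

Let phi_lip m t u : `|phi m t - phi m u| <= expR m%:R * B * `|t - u|.
Proof.
rewrite /phi; have := expR_lip m%:R (Num.min (B * `|t|) m%:R) (Num.min (B * `|u|) m%:R).
rewrite !ge_min !lexx !orbT => /(_ isT isT) /le_trans; apply.
rewrite -mulrA ler_wpM2l ?expR_ge0//.
have : `|B * `|t| - B * `|u| | <= B * `|t - u|.
  by rewrite -mulrBr normrM (ger0_norm B0) ler_wpM2l// ler_dist_dist.
move=> /(le_trans _); apply.
rewrite ler_norml; set v := B * _; set w := B * _.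
have := ler_norm (v - w); have := ler_norm (w - v); rewrite [`|w - v|]distrC.
by case: (leP v) => ?; case: (leP w) => ?; lra.
Qed.

Let measurable_phi m : measurable_fun setT (phi m).
Proof.
apply: (measurableT_comp (@measurable_expR R)).
apply: measurable_minr; last exact: measurable_cst.
by apply: measurable_funM; [exact: measurable_cst|exact: normr_measurable].
Qed.

(** By density the error term of [Rintegral_lip_dyadic_step_le] can be made as small as desired. The
    generation this takes is harmless, since the bound on the exponential sums is uniform in it. *)
Lemma truncated_exp_le m c h : 0 < h ->
  \int[mu]_(x in cube c h) phi m (f x - mean f (cube c h)) <= 3 / 2 * h ^+ n.
Proof.
move=> h0; apply/ler_addgt0Pr => e e0.
have K0 : 0 <= expR m%:R * B by rewrite mulr_ge0 ?expR_ge0.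
(* The added 1 keeps the denominator positive when [B] is 0. *)
pose d := e / (2 * (expR m%:R * B) + 1).
have d0 : 0 < d by rewrite divr_gt0//; lra.
have [N [s [sN sd]]] := integrable_approximable c h h0 _ (intf c h h0) d d0.
apply: (le_trans (Rintegral_lip_dyadic_step_le _ _ (measurable_phi m)
  (phi_lip m) _ _ _ _ _ h0 sN)).
apply: lerD.
  apply: le_trans (dyadic_sum_exp_le f intf L B L0 fL B0 BL N c h h0).
  by apply: le_dyadic_sum => // t; rewrite ler_expR ge_min lexx.
apply: (@le_trans _ _ (2 * (expR m%:R * B) * d)).
  by rewrite ler_wpM2l// mulr_ge0.
have <- : (2 * (expR m%:R * B) + 1) * d = e.
  by rewrite mulrC divfK// gt_eqF//; lra.
by rewrite ler_wpM2r ?(ltW d0)// lerDl.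
Qed.

(** Monotone convergence in the truncation level; at each point the truncation is eventually
    inactive. *)
Lemma exp_mean_oscillation_le c h : 0 < h ->
  (\int[mu]_(x in cube c h) (expR (B * `|f x - mean f (cube c h)|))%:E
    <= (3 / 2 * h ^+ n)%:E)%E.
Proof.
move=> h0; set m := mean f _.
pose g k (x : Rn R n) := (phi k (f x - m))%:E.
have mg k : measurable_fun (cube c h) (g k).
  exact: measurable_int (integrable_lip_subr _ _ (measurable_phi k) (phi_lip k) c h m h0).
have g0 k x : cube c h x -> (0 <= g k x)%E by rewrite lee_fin expR_ge0.
have nd x : cube c h x -> {homo g^~ x : k l / (k <= l)%N >-> (k <= l)%E}.
  move=> _ k l kl; rewrite lee_fin ler_expR le_min ge_min lexx/= ge_min.
  by rewrite ler_nat kl orbT.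
have gc : (\int[mu]_(x in cube c h) g k x)%E @[k --> \oo] -->
    (\int[mu]_(x in cube c h) limn (g^~ x))%E.
  apply: cvg_monotone_convergence;
    [exact: measurable_cube|exact: mg|exact: g0|exact: nd].
have {}gc : (\int[mu]_(x in cube c h) g k x)%E @[k --> \oo] -->
    (\int[mu]_(x in cube c h) (expR (B * `|f x - m|))%:E)%E.
  rewrite (_ : (\int[mu]_(x in _) (expR _)%:E =
    \int[mu]_(x in cube c h) limn (g^~ x))%E)//.
  apply: eq_integral => x _; apply/esym/cvg_lim => //.
  have [k kB] : exists k : nat, B * `|f x - m| <= k%:R.
    by exists (Num.truncn (B * `|f x - m|)).+1; exact/ltW/truncnS_gt.
  apply: cvg_near_cst; exists k => // l /= kl; rewrite /g /phi (min_idPl _)//.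
  by rewrite (le_trans kB)// ler_nat.
rewrite -(cvg_lim _ gc)//; apply: lime_le; first by apply/cvg_ex; eexists; exact: gc.
apply: nearW => k.
have ig := integrable_lip_subr _ _ (measurable_phi k) (phi_lip k) c h m h0.
rewrite -[leLHS]fineK ?lee_fin; first exact: truncated_exp_le.
by apply: integrable_fin_num; [exact: measurable_cube|exact: ig].
Qed.

End john_nirenberg.

(** * Roots of functions of bounded mean oscillation *)

(** The ratios [x / (x + y)] and [y / (x + y)] lie in the unit interval, where raising to a power
    [p <= 1] only increases, and they add up to 1. *)
Lemma powR_le_add {R : realType} (p x y : R) : 0 < p <= 1 -> 0 <= x -> 0 <= y ->
  (x + y) `^ p <= x `^ p + y `^ p.
Proof.
move=> /andP[p0 p1] x0 y0.
have [->|xy0] := eqVneq (x + y) 0; first by rewrite powR0 ?gt_eqF// addr_ge0 ?powR_ge0.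
have xy : 0 < x + y by rewrite lt_neqAle eq_sym xy0 addr_ge0.
have aux z : 0 <= z -> z <= x + y -> z / (x + y) * (x + y) `^ p <= z `^ p.
  move=> z0 zxy; rewrite -[X in _ <= X `^ _](divfK xy0) [leRHS]powRM ?divr_ge0 ?(ltW xy)//.
  rewrite ler_wpM2r ?powR_ge0//.
  have [->|z1] := eqVneq z 0; first by rewrite mul0r powR_ge0.
  rewrite -[leLHS]powRr1 ?divr_ge0 ?(ltW xy)// ger_powR//.
  by rewrite ler_pdivrMr// mul1r zxy divr_gt0// lt_neqAle eq_sym z1.
apply: le_trans (lerD (aux x x0 _) (aux y y0 _)); rewrite ?lerDl ?lerDr//.
by rewrite -mulrDl -mulrDl divff// mul1r.
Qed.

Lemma dist_powR_le {R : realType} (p x y : R) : 0 < p <= 1 -> 0 <= x -> 0 <= y ->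
  `|x `^ p - y `^ p| <= `|x - y| `^ p.
Proof.
move=> p01 x0 y0; wlog yx : x y x0 y0 / y <= x => [H|].
  by have [/H|/ltW/H] := leP y x; [apply|rewrite distrC (distrC x); apply].
have p0 : 0 <= p by case/andP: p01 => /ltW.
rewrite !ger0_norm ?subr_ge0 ?ge0_ler_powR ?nnegrE// lerBlDl.
rewrite -[X in X `^ _ <= _](subrK y) addrC powR_le_add// subr_ge0//.
Qed.

Lemma measurable_exp_powR {d} {T : measurableType d} {R : realType} (D : set T)
    (g : T -> R) (l a : R) :
  measurable_fun D g -> measurable_fun D (fun x => expR ((g x / l) `^ a)).
Proof.
move=> mg; have m1 : measurable_fun D (fun x => g x / l).
  by apply: measurable_funM => //; exact: measurable_cst.
have m2 : measurable_fun D (fun x => (g x / l) `^ a).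
  exact: (measurableT_comp (measurable_powR a) m1).
exact: (measurableT_comp (@measurable_expR R) m2).
Qed.

Lemma measurable_exp_cstM {d} {T : measurableType d} {R : realType} (D : set T)
    (g : T -> R) (k : R) :
  measurable_fun D g -> measurable_fun D (fun x => expR (k * g x)).
Proof.
move=> mg; apply: (measurableT_comp (@measurable_expR R)).
by apply: measurable_funM => //; exact: measurable_cst.
Qed.

Section root_of_BMO.
Context {R : realType} {n : nat}.
Local Notation mu := (@lebesgue_rV R n).
Variables (a : R) (b : Rn R n -> R) (L beta : R).
Hypothesis a1 : 1 < a.
Local Notation f := (fun x => b x `^ a).
Hypothesis L1b : L1loc b.
Hypothesis L1f : L1loc f.
Hypothesis b0 : {ae mu, forall x, 0 <= b x}.
Hypothesis L0 : 0 < L.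
Hypothesis fL : (bmo_norm f <= L%:E)%E.
Hypothesis beta0 : 0 < beta.
Hypothesis beta_small : expR (beta * (8 + 2 ^+ n)) <= 5 / 4.
Implicit Types (c : 'rV[R]_n) (h : R).

Let a0 : 0 < a. Proof. exact: lt_trans a1. Qed.
Let p01 : 0 < a^-1 <= 1.
Proof. by rewrite invr_gt0 a0 invf_le1// ltW. Qed.

Let intb c h : 0 < h -> mu.-integrable (cube c h) (EFin \o b).
Proof. by move=> _; exact: L1loc_integrable. Qed.

Let intf c h : 0 < h -> mu.-integrable (cube c h) (EFin \o f).
Proof. by move=> _; exact: L1loc_integrable. Qed.

Let powRaK (x : R) : 0 <= x -> (x `^ a) `^ a^-1 = x.
Proof. by move=> x0; rewrite -powRrM divff ?gt_eqF// powRr1. Qed.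

Let powRVK (x : R) : 0 <= x -> (x `^ a^-1) `^ a = x.
Proof. by move=> x0; rewrite -powRrM mulVf ?gt_eqF// powRr1. Qed.

Lemma bmo_oscillation_le c h : 0 < h ->
  \int[mu]_(x in cube c h) `|f x - mean f (cube c h)| <= L * h ^+ n.
Proof.
move=> h0; have hn0 : 0 < h ^+ n by exact: exprn_gt0.
have : (emean (fun x => `|f x - mean f (cube c h)|%:E) (cube c h) <= L%:E)%E.
  apply: le_trans fL; apply: ereal_sup_ubound; exists (cube c h) => //.
  by exists c, h.
have ii := integrable_norm_subr f intf c h (mean f (cube c h)) h0.
rewrite /emean [X in fine X](lebesgue_cube c h h0) /Rintegral.
have := integrable_fin_num (measurable_cube c h) ii.
move=> /fineK <-; rewrite -EFinM lee_fin /= => H.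
by rewrite mulrC -ler_pdivrMl.
Qed.

Let root_mean c h := (mean f (cube c h)) `^ a^-1.

Let mean_ge0 c h : 0 < h -> 0 <= mean f (cube c h).
Proof.
move=> h0; rewrite meanE// mulr_ge0 ?invr_ge0 ?exprn_ge0 ?(ltW h0)//.
by apply: Rintegral_ge0 => x _; exact: powR_ge0.
Qed.

Let dist_root_mean c h x : 0 < h -> 0 <= b x ->
  `|b x - root_mean c h| <= `|f x - mean f (cube c h)| `^ a^-1.
Proof.
move=> h0 bx; rewrite -[X in `|X - _|](powRaK _ bx).
by apply: dist_powR_le => //; [exact: powR_ge0|exact: mean_ge0].
Qed.

Let powRV_le_affine (t : R) : 0 <= t -> t `^ a^-1 <= L `^ a^-1 * (1 + t / L).
Proof.
move=> t0; have tL : 0 <= t / L by rewrite divr_ge0// ltW.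
rewrite -[X in X `^ _ <= _](divfK (lt0r_neq0 L0)) mulrC powRM// ?(ltW L0)//.
rewrite ler_wpM2l ?powR_ge0//.
apply: (@le_trans _ _ ((1 + t / L) `^ a^-1)).
  by rewrite ge0_ler_powR ?nnegrE ?addr_ge0 ?invr_ge0 ?(ltW a0)// lerDr.
rewrite -[leRHS]powRr1 ?addr_ge0// ler_powR ?lerDl//.
by case/andP: p01.
Qed.

Lemma dist_mean_root_mean_le c h : 0 < h ->
  `|mean b (cube c h) - root_mean c h| <= 2 * L `^ a^-1.
Proof.
move=> h0; have hn0 : 0 < h ^+ n by exact: exprn_gt0.
rewrite -(ler_pM2r hn0) (le_trans (norm_mean_subr_le b intb c h _ h0))//.
have mQ := measurable_cube c h.
have ib := integrable_norm_subr b intb c h (root_mean c h) h0.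
have jf := integrable_norm_subr f intf c h (mean f (cube c h)) h0.
pose K := L `^ a^-1 / L.
have iK := @integrableZl _ _ _ _ _ mQ K _ jf.
have ic := @integrable_cube_cst R n c h (L `^ a^-1) h0.
have iaff := integrable_addr c h _ _ ic iK.
apply: (@le_trans _ _ (\int[mu]_(x in cube c h)
    (L `^ a^-1 + K * `|f x - mean f (cube c h)|))).
  rewrite /Rintegral fine_le//.
  - by apply: integrable_fin_num; [exact: mQ|exact: ib].
  - by apply: integrable_fin_num; [exact: mQ|exact: iaff].
  (* The pointwise bound needs [0 <= b x] and so holds almost everywhere only. *)
  apply: ae_ge0_le_integral; first exact: mQ.
  - by move=> x _; rewrite lee_fin.
  - exact: measurable_int ib.
  - by move=> x _; rewrite lee_fin addr_ge0 ?powR_ge0// mulr_ge0//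
      divr_ge0 ?powR_ge0// ltW.
  - exact: measurable_int iaff.
  - apply: filterS b0 => x bx _; rewrite lee_fin.
    rewrite (le_trans (dist_root_mean _ _ _ h0 bx))//.
    rewrite (le_trans (powRV_le_affine _ _))// mulrDr mulr1 /K.
    by rewrite mulrA mulrAC.
rewrite (RintegralD mQ ic iK) Rintegral_cube_cst// (RintegralZl _ mQ jf).
have K0 : 0 <= K by rewrite divr_ge0 ?powR_ge0// ltW.
have := ler_wpM2l K0 (bmo_oscillation_le c h h0).
by rewrite /K [X in _ <= X -> _]mulrA (divfK (lt0r_neq0 L0)); lra.
Qed.

Lemma powR_oscillation_le c h x : 0 < h -> 0 <= b x ->
  (`|b x - mean b (cube c h)| / (3 * (L / beta) `^ a^-1)) `^ a <=
  beta + beta / L * `|f x - mean f (cube c h)|.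
Proof.
move=> h0 bx; set t := `|f x - _|; have t0 : 0 <= t by exact: normr_ge0.
have pV : 0 <= a^-1 by case/andP: p01 => /ltW.
have tL0 : 0 <= t + L by rewrite addr_ge0// ltW.
have Lb0 : 0 < L / beta by exact: divr_gt0.
have H : `|b x - mean b (cube c h)| <= 3 * (t + L) `^ a^-1.
  have := dist_root_mean c h x h0 bx; rewrite -/t.
  have := dist_mean_root_mean_le c h h0.
  have : t `^ a^-1 <= (t + L) `^ a^-1.
    by rewrite ge0_ler_powR ?nnegrE// lerDl ltW.
  have : L `^ a^-1 <= (t + L) `^ a^-1.
    by rewrite ge0_ler_powR ?nnegrE ?(ltW L0)// lerDr.
  have := ler_normB (b x - root_mean c h) (mean b (cube c h) - root_mean c h).
  rewrite [X in `|X| <= _](_ : _ = b x - mean b (cube c h)); last by ring.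
  lra.
have l0 : 0 < 3 * (L / beta) `^ a^-1 by rewrite mulr_gt0// powR_gt0.
apply: (@le_trans _ _ (((t + L) / (L / beta)) `^ a^-1 `^ a)).
  rewrite ge0_ler_powR ?nnegrE ?(ltW a0) ?powR_ge0 ?divr_ge0 ?(ltW l0)//.
  by rewrite ler_pdivrMr// (le_trans H)// mulrCA -powRM ?divfK ?(lt0r_neq0 Lb0)//
    ?divr_ge0// ltW.
rewrite powRVK; last by rewrite divr_ge0// ltW.
by rewrite le_eqVlt; apply/orP; left; apply/eqP; field; rewrite !gt_eqF.
Qed.

(** The factor [expR beta <= 5 / 4] times the John-Nirenberg bound [3 / 2] is [15 / 8]; subtracting
    1 for the Young function leaves [7 / 8], below the admissible 1. *)
Lemma luxemburg_norm_le c h : 0 < h ->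
  (luxemburg_norm (exp_young a) (fun x => b x - mean b (cube c h))%R (cube c h)
    <= (3 * (L / beta) `^ a^-1)%:E)%E.
Proof.
move=> h0; apply: ereal_inf_lbound; set l := 3 * _.
have l0 : 0 < l by rewrite mulr_gt0// powR_gt0// divr_gt0.
exists l => //; split => //.
have hn0 : 0 < h ^+ n by exact: exprn_gt0.
have mQ := measurable_cube c h.
set phi := fun x => expR ((`|b x - mean b (cube c h)| / l) `^ a).
have mphi : measurable_fun (cube c h) phi.
  apply: measurable_exp_powR; apply/measurable_EFinP.
  exact: measurable_int (integrable_norm_subr b intb c h (mean b (cube c h)) h0).
have phi1 x : 1 <= phi x by rewrite -expR0 ler_expR powR_ge0.
have beta_le : expR beta <= 5 / 4.
  apply: le_trans beta_small; rewrite ler_expR ler_peMr ?(ltW beta0)//.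
  by have : (0 : R) <= 2 ^+ n by []; lra.
have B0 : 0 <= beta / L by rewrite divr_ge0// ltW.
(* The exponent [beta / L] cancels [L], so the smallness condition concerns [beta] and [n] alone. *)
have BL : expR (beta / L * (L * (8 + 2 ^+ n))) <= 5 / 4.
  by rewrite mulrA divfK// lt0r_neq0.
have JN := exp_mean_oscillation_le f intf L (beta / L) L0 bmo_oscillation_le B0 BL c h h0.
have mosc : measurable_fun (cube c h)
    (fun x => (expR (beta / L * `|f x - mean f (cube c h)|))%:E).
  apply/measurable_EFinP; apply: measurable_exp_cstM; apply/measurable_EFinP.
  exact: measurable_int (integrable_norm_subr f intf c h (mean f (cube c h)) h0).
have H1 : (\int[mu]_(x in cube c h) (phi x)%:E <= (15 / 8 * h ^+ n)%:E)%E.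
  apply: (@le_trans _ _ (\int[mu]_(x in cube c h) ((expR beta)%:E *
      (expR (beta / L * `|f x - mean f (cube c h)|))%:E))%E).
    apply: ae_ge0_le_integral; first exact: mQ.
    - by move=> x _; rewrite lee_fin expR_ge0.
    - exact/measurable_EFinP.
    - by move=> x _; rewrite -EFinM lee_fin mulr_ge0 ?expR_ge0.
    - exact: measurable_funeM.
    - apply: filterS b0 => x bx _; rewrite -EFinM lee_fin -expRD ler_expR.
      exact: powR_oscillation_le.
  rewrite ge0_integralZl// ?lee_fin ?expR_ge0//.
  apply: (@le_trans _ _ ((5 / 4)%:E * (3 / 2 * h ^+ n)%:E)%E).
    apply: lee_pmul; [|apply: integral_ge0 => x _| |exact: JN];
      by rewrite lee_fin ?expR_ge0.
  by rewrite -EFinM lee_fin; lra.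
(* Adding the volume back, instead of subtracting it, keeps all integrands nonnegative. *)
have H2 : (\int[mu]_(x in cube c h) (phi x)%:E =
    \int[mu]_(x in cube c h) (phi x - 1)%:E + (h ^+ n)%:E)%E.
  rewrite -[X in (_ + X)%E](_ : \int[mu]_(x in cube c h) (cst 1%E x) = _)%E; last first.
    by rewrite integral_cst// mul1e [LHS]lebesgue_cube.
  rewrite -ge0_integralD.
  - by apply: eq_integral => x _; rewrite -EFinD subrK.
  - exact: mQ.
  - by move=> x _; rewrite lee_fin subr_ge0.
  - apply/measurable_EFinP; apply: (measurable_funB mphi).
    exact: measurable_cst.
  - by move=> x _; rewrite lee_fin.
  - exact: measurable_cst.
rewrite /emean [X in fine X](lebesgue_cube c h h0) /=.
rewrite muleC lee_pdivrMr// mul1e.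
have : (\int[mu]_(x in cube c h) (phi x - 1)%:E + (h ^+ n)%:E <=
   (7 / 8 * h ^+ n)%:E + (h ^+ n)%:E)%E.
  by rewrite -H2 (le_trans H1)// -EFinD lee_fin; lra.
rewrite leeD2rE// => /le_trans; apply; rewrite lee_fin; lra.
Qed.

End root_of_BMO.

(** * From a single cube to the norms *)

Lemma bmo_norm_ge0 {R : realType} {n : nat} (f : Rn R n -> R) :
  (0 <= bmo_norm f)%E.
Proof.
apply: (@le_trans _ _ (emean
    (fun x => `|f x - mean f (cube 0 1)|%:E) (cube (0 : 'rV[R]_n) 1))).
  rewrite /emean mule_ge0 ?lee_fin ?invr_ge0 ?fine_ge0//.
  by apply: integral_ge0 => x _; rewrite lee_fin.
apply: ereal_sup_ubound; exists (cube (0 : 'rV[R]_n) 1) => //.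
by exists 0, 1.
Qed.

(** The estimate on cubes holds for every positive [L] above the norm [N]. If [N] is positive, take
    [L = N]; if it is 0, let [L] tend to 0. *)
Lemma osc_exp_norm_le {R : realType} {n : nat} (a beta : R) (b : Rn R n -> R) :
  1 < a -> 0 < beta -> expR (beta * (8 + 2 ^+ n)) <= 5 / 4 ->
  root_BMO n a b ->
  (osc_exp_norm a b <=
   (3 * beta^-1 `^ a^-1)%:E * bmo_norm (fun x => b x `^ a)%R `^ a^-1)%E.
Proof.
move=> a1 beta0 beta_small [L1b b0 [L1f]].
have a0 : 0 < a by exact: lt_trans a1.
have := bmo_norm_ge0 (fun x => b x `^ a).
case NE : (bmo_norm _) => [N| |]//; rewrite lee_fin => N0 _.
apply: ge_ereal_sup => _ [_ [c [h [h0 ->]]] <-].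
rewrite poweR_EFin -EFinM.
have H L : 0 < L -> N <= L -> (luxemburg_norm (exp_young a)
    (fun x => b x - mean b (cube c h))%R (cube c h) <=
    (3 * (L / beta) `^ a^-1)%:E)%E.
  move=> L0 NL; apply: luxemburg_norm_le => //.
  by rewrite NE lee_fin.
have [N00|Nneq] := eqVneq N 0.
  rewrite N00 powR0 ?gt_eqF ?invr_gt0// mulr0.
  apply/lee_addgt0Pr => e e0; rewrite add0e.
  have e30 : 0 < e / 3 by lra.
  (* This value of [L] turns the bound on cubes into exactly [e]. *)
  have -> : e = 3 * ((beta * (e / 3) `^ a) / beta) `^ a^-1.
    rewrite (mulrC beta) mulfK ?lt0r_neq0// -powRrM mulfV ?lt0r_neq0//.
    by rewrite powRr1 ?(ltW e30)//; lra.
  by apply: H; rewrite ?N00 ?ltW// mulr_gt0// powR_gt0.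
have N1 : 0 < N by rewrite lt_neqAle eq_sym Nneq.
apply: le_trans (H N N1 (lexx _)) _.
by rewrite lee_fin [N / beta]mulrC powRM ?invr_ge0 ?(ltW beta0)// mulrA.
Qed.

Theorem theorem1p5 (R : realType) (n : nat) (n_gt0 : (0 < n)%N)
    (a : R) (a_gt1 : 1 < a) :
  root_BMO n a `<=` Osc_exp n a /\
  exists C : R, forall b : Rn R n -> R, root_BMO n a b ->
    (osc_exp_norm a b <= C%:E * bmo_norm (fun x => b x `^ a)%R `^ a^-1)%E.
Proof.
(* The largest [beta] allowed by the smallness condition; it depends on [n] only, so the constant
   depends on [n] and [a] but not on [b]. *)
pose beta : R := ln (5 / 4) / (8 + 2 ^+ n).
have d0 : (0 : R) < 8 + 2 ^+ n by rewrite addr_gt0// exprn_gt0.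
have beta0 : 0 < beta by rewrite divr_gt0// ln_gt0; lra.
have beta_small : expR (beta * (8 + 2 ^+ n)) <= 5 / 4.
  by rewrite divfK ?lt0r_neq0// lnK// posrE; lra.
have H b := osc_exp_norm_le a beta b a_gt1 beta0 beta_small.
split=> [b Hb|]; last by exists (3 * beta^-1 `^ a^-1).
have [L1b _ [_ foo]] := Hb; split => //; apply: le_lt_trans (H b Hb) _.
by rewrite lte_mul_pinfty ?lee_fin ?mulr_ge0 ?powR_ge0// poweR_lty.
Qed.
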